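(* Let $X\subset\mathbb{R}^n$ be a closed, unbounded and convex set, let $I=\{1,\ldots,m\}$, let $\alpha>0$, and let $f=(f_1,\ldots,f_m):\mathbb{R}^n\to\mathbb{R}^m$ be an $\mathbb{R}^m_+$-$\alpha$-robustly quasiconvex mapping such that each $f_i:\mathbb{R}^n\to\mathbb{R}$ is (proper and) lower semicontinuous. If $$X^\infty\cap\Big(\bigcup_{i\in I}\mathcal{K}_q(f_i)\Big)=\{0\},$$ then there exists $\varepsilon>0$ such that for all $u\in\mathbb{R}^{m\times n}$ with $\|u\|<\varepsilon$, the following statements hold: (a) $f^u$ is bounded from below on $X$, i.e., there exists $a\in\mathbb{R}^m$ with $f^u(X)\subset a+\mathbb{R}^m_+$. (b) $\mathrm{Sol}^w(u)$ is nonempty and compact. (c) $\mathop{\mathrm{Lim\,sup}}_{u\to0}\mathrm{Sol}^w(u)\subset\mathrm{Sol}^w(0)$, i.e., the solution mapping $\mathrm{Sol}^w(\cdot)$ is closed at $0$. (d) $\mathrm{Sol}^w(\cdot)$ is upper semicontinuous at $0$.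
   Context: All spaces are Euclidean; $\mathbb{R}^m_+$ is the nonnegative orthant. For $u=(u_1,\ldots,u_m)\in\mathbb{R}^{m\times n}$ with $u_i\in\mathbb{R}^n$, put $\|u\|:=\max_{i\in I}\|u_i\|$ and $\langle u,x\rangle:=(\langle u_1,x\rangle,\ldots,\langle u_m,x\rangle)$. A mapping $g=(g_1,\ldots,g_m):\mathbb{R}^n\to\mathbb{R}^m$ is $\mathbb{R}^m_+$-quasiconvex if for every $y\in\mathbb{R}^m$ the set $\{x\in\mathbb{R}^n: g_i(x)\le y_i,\ i=1,\ldots,m\}$ is convex (equivalently, each $g_i$ is quasiconvex). $f$ is $\mathbb{R}^m_+$-$\alpha$-robustly quasiconvex if $x\mapsto f(x)+\langle u,x\rangle$ is $\mathbb{R}^m_+$-quasiconvex for all $u\in\mathbb{R}^{m\times n}$ with $\|u\|<\alpha$. $f^u(x):=f(x)-\langle u,x\rangle$, with components $f_i^{u_i}(x)=f_i(x)-\langle u_i,x\rangle$. $\mathrm{Sol}^w(u)$ is the set of weak Pareto solutions of minimizing $f^u$ over $X$, i.e., of all $\bar x\in X$ such that there is no $x\in X$ with $f_i^{u_i}(x)<f_i^{u_i}(\bar x)$ for all $i\in I$. Asymptotic cone: $X^\infty:=\{d\in\mathbb{R}^n:\exists\, t_k\to+\infty,\ \exists\, x_k\in X,\ x_k/t_k\to d\}$. $q$-asymptotic function of $\varphi:\mathbb{R}^n\to\mathbb{R}$: $\varphi_q^\infty(d):=\sup_{x\in\mathbb{R}^n}\sup_{t>0}\frac{\varphi(x+td)-\varphi(x)}{t}$.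 $\mathcal{K}_q(\varphi):=\{d\in\mathbb{R}^n:\varphi_q^\infty(d)\le0\}$. For a set-valued mapping $F$: $\mathop{\mathrm{Lim\,sup}}_{u\to\bar u}F(u)$ is the set of all $y$ for which there exist sequences $u_k\to\bar u$, $y_k\to y$ with $y_k\in F(u_k)$ for all $k$. $F$ is upper semicontinuous at $\bar u$ if for every open set $V\supset F(\bar u)$ there is a neighborhood $U$ of $\bar u$ with $F(u)\subset V$ for all $u\in U$. *)

(* Defs.v *)
From mathcomp Require Import all_boot all_order all_algebra.
From mathcomp Require Import all_classical all_reals all_analysis.

Set Implicit Arguments.
Unset Strict Implicit.
Unset Printing Implicit Defensive.

Import Order.TTheory GRing.Theory Num.Theory.
Import numFieldNormedType.Exports.

Local Open Scope classical_set_scope.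
Local Open Scope ring_scope.

(* Points of R^n are row vectors and u = (u_1, ..., u_m) is the matrix with
   rows u_i.  The library equips 'M[R]_(m, n) with the entrywise max norm; in
   finite dimension its topology and its bounded sets are the Euclidean ones,
   so library notions are used for these.  Wherever a numerical value of a norm
   matters, the Euclidean norm below is used instead. *)

Definition dot (R : realType) (n : nat) (u v : 'rV[R]_n) : R :=
  \sum_(j < n) u ord0 j * v ord0 j.

Definition enorm (R : realType) (n : nat) (v : 'rV[R]_n) : R :=
  Num.sqrt (dot v v).

Definition fam_norm (R : realType) (m n : nat) (u : 'M[R]_(m, n)) : R :=
  \big[Num.max/0]_(i < m) enorm (row i u).

Definition fam_dot (R : realType) (m n : nat)
    (u : 'M[R]_(m, n)) (x : 'rV[R]_n) : 'rV[R]_m :=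
  \row_(i < m) dot (row i u) x.

Definition comp_fun (R : realType) (m n : nat)
    (g : 'rV[R]_n -> 'rV[R]_m) (i : 'I_m) : 'rV[R]_n -> R :=
  fun x => g x ord0 i.

Definition nonneg_orthant (R : realType) (m : nat) : set 'rV[R]_m :=
  [set z | forall i, 0 <= z ord0 i].
Arguments nonneg_orthant : clear implicits.

Definition quasiconvex_map (R : realType) (m n : nat)
    (g : 'rV[R]_n -> 'rV[R]_m) : Prop :=
  forall y : 'rV[R]_m,
    convex_set [set x : 'rV[R]_n | forall i, comp_fun g i x <= y ord0 i].

Definition robustly_quasiconvex_map (R : realType) (m n : nat) (alpha : R)
    (f : 'rV[R]_n -> 'rV[R]_m) : Prop :=
  forall u : 'M[R]_(m, n), fam_norm u < alpha ->
    quasiconvex_map (fun x => f x + fam_dot u x).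

Definition perturb (R : realType) (m n : nat)
    (f : 'rV[R]_n -> 'rV[R]_m) (u : 'M[R]_(m, n)) : 'rV[R]_n -> 'rV[R]_m :=
  fun x => f x - fam_dot u x.

Definition weak_pareto (R : realType) (m n : nat) (X : set 'rV[R]_n)
    (g : 'rV[R]_n -> 'rV[R]_m) : set 'rV[R]_n :=
  [set xb | X xb /\
     ~ exists2 x, X x & forall i, comp_fun g i x < comp_fun g i xb].

Definition Solw (R : realType) (m n : nat) (X : set 'rV[R]_n)
    (f : 'rV[R]_n -> 'rV[R]_m) (u : 'M[R]_(m, n)) : set 'rV[R]_n :=
  weak_pareto X (perturb f u).

Definition asymptotic_cone (R : realType) (n : nat) (X : set 'rV[R]_n) :
    set 'rV[R]_n :=
  [set d | exists (t : nat -> R) (x : nat -> 'rV[R]_n),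
     [/\ t @ \oo --> +oo, forall k, X (x k) &
         (fun k => (t k)^-1 *: x k) @ \oo --> d]].

Definition q_asymptotic (R : realType) (n : nat) (phi : 'rV[R]_n -> R)
    (d : 'rV[R]_n) : \bar R :=
  ereal_sup [set ereal_sup [set ((phi (x + t *: d) - phi x) / t)%:E
                           | t in [set t : R | 0 < t]]
            | x in [set: 'rV[R]_n]].

Definition Kq (R : realType) (n : nat) (phi : 'rV[R]_n -> R) :
    set 'rV[R]_n :=
  [set d | (q_asymptotic phi d <= 0)%E].

Definition Lim_sup (S T : topologicalType) (F : S -> set T) (ub : S) : set T :=
  [set y | exists (u : nat -> S) (z : nat -> T),
     [/\ u @ \oo --> ub, z @ \oo --> y & forall k, F (u k) (z k)]].

Definition upper_semicontinuous_at (S T : topologicalType)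
    (F : S -> set T) (ub : S) : Prop :=
  forall V : set T, open V -> F ub `<=` V -> \forall u \near ub, F u `<=` V.

(* Main.v *)
Require Import Defs.
From mathcomp Require Import all_boot all_order all_algebra.
From mathcomp Require Import all_classical all_reals all_analysis.
From mathcomp Require Import lra.
Import Order.TTheory GRing.Theory Num.Theory.
Import numFieldNormedType.Exports.
Local Open Scope classical_set_scope.
Local Open Scope ring_scope.

(** The whole statement rests on one estimate, [linear_growth]: under the
    asymptotic hypothesis there are [eta > 0] and [r] such that
    [f_i x > eta * |x|] for every [i] and every [x] of [X] with [|x| >= r].

    Suppose it fails for some [i].  Compactness of the unit sphere yields points
    [x_k] of [X] with [|x_k| -> +oo], [x_k / |x_k| -> d], [d != 0] and
    [f_i x_k <= eta_k * |x_k|] with [eta_k -> 0]; in particular [d] is in the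
    asymptotic cone of [X].  Fix [y] and a small [del > 0].  The tilted function
    [f_i - del * <d, .>] is still quasiconvex, and it tends to [-oo] along
    [x_k], because [<d, x_k>] grows like [|d|^2 * |x_k|].  Its value on the
    segment from [y] to a far [x_k] is therefore at most its value at [y].
    The points dividing these segments at the fraction [s / |x_k|] converge to
    [y + s *: d], so lower semicontinuity, followed by [del -> 0], gives
    [f_i (y + s *: d) <= f_i y].  This means that [d] is in [Kq f_i]
    ([sublinear_direction_Kq]), which is excluded.

    A perturbation [u] changes [f_i x] by at most [n * |u| * |x|], so for small
    [u] all components of [f^u] keep a common linear growth with slope
    [eta / 2].  Hence each component attains its minimum on [X]
    ([coercive_argmin]): this bounds [f^u] from below, and a minimizer of a
    single component is a weak Pareto solution.  Comparing a weak solution with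
    one fixed point of [X] bounds it, uniformly in [u] ([Solw_bounded]).
    Finally the graph of [Solw X f] is closed, since strict domination persists
    under small changes of the solution and of [u] ([near_not_Solw]).  The
    graph property gives the outer limit statement and, with the bounds,
    compactness; a closed graph and locally bounded values give upper
    semicontinuity. *)

(** * Inner products and norms *)

Lemma dotDr {R : realType} {n : nat} (u x y : 'rV[R]_n) :
  dot u (x + y) = dot u x + dot u y.
Proof.
by rewrite /dot -big_split /=; apply: eq_bigr => j _; rewrite mxE mulrDr.
Qed.

Lemma dotZr {R : realType} {n : nat} (a : R) (u x : 'rV[R]_n) :
  dot u (a *: x) = a * dot u x.
Proof.
by rewrite /dot mulr_sumr; apply: eq_bigr => j _; rewrite mxE mulrCA.
Qed.

Lemma dotC {R : realType} {n : nat} (u x : 'rV[R]_n) : dot u x = dot x u.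
Proof. by apply: eq_bigr => j _; rewrite mulrC. Qed.

Lemma dotZl {R : realType} {n : nat} (a : R) (u x : 'rV[R]_n) :
  dot (a *: u) x = a * dot u x.
Proof. by rewrite dotC dotZr dotC. Qed.

Lemma dotBr {R : realType} {n : nat} (u x y : 'rV[R]_n) :
  dot u (x - y) = dot u x - dot u y.
Proof. by rewrite dotDr -scaleN1r dotZr mulN1r. Qed.

Lemma dot_gt0 {R : realType} {n : nat} (d : 'rV[R]_n) : d != 0 -> 0 < dot d d.
Proof.
move=> d0; have ge0 : forall j, true -> 0 <= d ord0 j * d ord0 j.
  by move=> j _; rewrite -expr2 sqr_ge0.
rewrite lt0r sumr_ge0 // andbT; apply: contra_neq d0 => /eqP.
rewrite psumr_eq0 // => /allP d0; apply/rowP => j; rewrite mxE; apply/eqP.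
by have := d0 j (mem_index_enum j); rewrite mulf_eq0 orbb.
Qed.

Lemma enormZ {R : realType} {n : nat} (a : R) (v : 'rV[R]_n) :
  enorm (a *: v) = `|a| * enorm v.
Proof.
by rewrite /enorm dotZl dotZr mulrA -expr2 sqrtrM ?sqr_ge0// sqrtr_sqr.
Qed.

Lemma normr_coord_le {R : realType} {m n : nat} (u : 'M[R]_(m, n)) i j :
  `|u i j| <= `|u|.
Proof.
rewrite [leRHS]mx_normrE.
exact: (le_bigmax _ (fun ij : 'I_m * 'I_n => `|u ij.1 ij.2|) (i, j)).
Qed.

Lemma normr_coord_le_enorm {R : realType} {n : nat} (v : 'rV[R]_n) j :
  `|v ord0 j| <= enorm v.
Proof.
rewrite -sqrtr_sqr ler_wsqrtr// /dot (bigD1 j)//= expr2 lerDl.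
by apply: sumr_ge0 => k _; rewrite -expr2 sqr_ge0.
Qed.

(** Carries smallness from the Euclidean norm of a family over to the entrywise
    norm, which defines the topology in the semicontinuity statements. *)
Lemma normr_le_fam_norm {R : realType} {m n : nat} (u : 'M[R]_(m, n)) :
  `|u| <= fam_norm u.
Proof.
rewrite -[`|u|]/(mx_norm u).
have [->|/mx_norm_neq0 [[i j] ->]] := eqVneq (mx_norm u) 0.
  exact: bigmax_ge_id.
apply: le_trans (le_bigmax _ (fun i => enorm (row i u)) i).
by apply: le_trans (normr_coord_le_enorm _ j); rewrite mxE.
Qed.

Lemma normr_dot_le {R : realType} {m n : nat} (u : 'M[R]_(m, n)) i
    (x : 'rV[R]_n) : `|dot (row i u) x| <= n%:R * `|u| * `|x|.
Proof.
apply: le_trans (ler_norm_sum _ _ _) _.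
have -> : n%:R * `|u| * `|x| = \sum_(j < n) `|u| * `|x|.
  by rewrite sumr_const card_ord -[RHS]mulr_natl mulrA.
by apply: ler_sum => j _; rewrite normrM mxE ler_pM// normr_coord_le.
Qed.

Lemma cvg_dot_row {R : realType} {m n : nat} {T : Type} {F : set_system T}
    {FF : Filter F} (p : T -> 'M[R]_(m, n)) (q : T -> 'rV[R]_n) u x i :
  p @ F --> u -> q @ F --> x ->
  (fun t => dot (row i (p t)) (q t)) @ F --> dot (row i u) x.
Proof.
move=> pu qx; rewrite /dot; apply: cvg_big => [|j _].
  exact: add_continuous.
under eq_cvg do rewrite mxE; rewrite mxE; apply: cvgM.
  exact: (cvg_comp _ _ pu (@coord_continuous R m n i j u)).
exact: (cvg_comp _ _ qx (@coord_continuous R 1 n ord0 j x)).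
Qed.

Lemma cvg_dot {R : realType} {n : nat} {T : Type} {F : set_system T}
    {FF : Filter F} (q : T -> 'rV[R]_n) u x :
  q @ F --> x -> (fun t => dot u (q t)) @ F --> dot u x.
Proof.
move=> qx; rewrite -(row_id ord0 u); apply: cvg_dot_row => //.
exact: cvg_cst.
Qed.

(** * Robust quasiconvexity of one component *)

Definition quasiconvex {R : realType} {n : nat} (g : 'rV[R]_n -> R) : Prop :=
  forall x y t, 0 <= t <= 1 -> g (x + t *: (y - x)) <= Num.max (g x) (g y).

(** The levels of the other components are taken as large as the two points
    require, so that only the [i]-th inequality constrains. *)
Lemma quasiconvex_comp {R : realType} {m n : nat} {g : 'rV[R]_n -> 'rV[R]_m} :
  quasiconvex_map g -> forall i, quasiconvex (comp_fun g i).
Proof.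
move=> qg i x y t t01.
pose lev : 'rV[R]_m := \row_j Num.max (comp_fun g j x) (comp_fun g j y).
have := qg lev y x (Itv01 (andP t01).1 (andP t01).2).
have -> : conv (Itv01 (andP t01).1 (andP t01).2)
    (y : convex_lmodType _) (x : convex_lmodType _) = x + t *: (y - x).
by rewrite /conv/= scalerBl scale1r scalerBr addrC addrAC -addrA.
rewrite !inE /= => levP; have := levP _ _ i; rewrite mxE.
by apply=> j; rewrite mxE le_max lexx ?orbT.
Qed.

Definition robustly_quasiconvex {R : realType} {n : nat} (alpha : R)
    (phi : 'rV[R]_n -> R) : Prop :=
  forall v, enorm v < alpha -> quasiconvex (fun x => phi x + dot v x).

Lemma robustly_quasiconvex_comp {R : realType} {m n : nat} {alpha : R}
    {f : 'rV[R]_n -> 'rV[R]_m} : 0 < alpha ->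
  robustly_quasiconvex_map alpha f ->
  forall i, robustly_quasiconvex alpha (comp_fun f i).
Proof.
move=> alpha0 rqf i v va.
pose u : 'M[R]_(m, n) := \matrix_(_ , j) v ord0 j.
have rowu k : row k u = v by apply/rowP => j; rewrite !mxE.
have /rqf /quasiconvex_comp /(_ i) : fam_norm u < alpha.
  by apply: bigmax_lt => // k _; rewrite rowu.
by congr quasiconvex; apply/funext => x; rewrite /comp_fun !mxE rowu.
Qed.

(** * Directions of sublinear growth *)

Lemma lsc_near {R : realType} {T : topologicalType} {phi : T -> R} :
  lower_semicontinuous (fun x => (phi x)%:E) ->
  forall x a, a < phi x -> \forall y \near x, a < phi y.
Proof.
move=> lsc x a; rewrite -lte_fin => /lsc [V Vx Vphi].
by apply: filterS Vx => y /Vphi; rewrite lte_fin.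
Qed.

Lemma Kq_nonincreasing {R : realType} {n : nat} {phi : 'rV[R]_n -> R} {d} :
  (forall x t, 0 < t -> phi (x + t *: d) <= phi x) -> Kq phi d.
Proof.
move=> phid; apply: ub_ereal_sup => _ [x _ <-].
apply: ub_ereal_sup => _ [t /= t0 <-].
by rewrite lee_fin pmulr_lle0 ?invr_gt0// subr_le0 phid.
Qed.

(** If [phi] grows sublinearly along points [x k] escaping to infinity in the
    direction [d], then subtracting [del * dot d] makes it tend to [-oo] along
    them; quasiconvexity of this tilted function on the segments from [y] to
    [x k] then carries the value at [y] over to the ray from [y] along [d], up
    to an error that vanishes with [del]. *)
Lemma sublinear_direction_Kq {R : realType} {n : nat} (alpha : R)
    (phi : 'rV[R]_n -> R) (t eta : nat -> R) (x : nat -> 'rV[R]_n)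
    (d : 'rV[R]_n) :
  0 < alpha -> robustly_quasiconvex alpha phi ->
  lower_semicontinuous (fun y => (phi y)%:E) ->
  d != 0 -> t @ \oo --> +oo -> eta @ \oo --> 0 ->
  (fun k => (t k)^-1 *: x k) @ \oo --> d ->
  (forall k, phi (x k) <= eta k * t k) -> Kq phi d.
Proof.
move=> alpha0 rq lsc d0 ty eta0 xd phix; apply: Kq_nonincreasing => y s s0.
rewrite leNgt; apply/negP => lt_phi.
(* A level strictly between the two values, for lower semicontinuity to hold
   onto. *)
pose a := (phi y + phi (y + s *: d)) / 2.
have [ya ad] : phi y < a /\ a < phi (y + s *: d) by rewrite /a; split; lra.
have dd := dot_gt0 _ d0.
have ed : 0 <= enorm d by exact: sqrtr_ge0.
have e1 : 0 < enorm d + 1 by rewrite ltr_wpDl.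
have sd : 0 < s * dot d d by exact: mulr_gt0.
have ay : 0 < a - phi y by rewrite subr_gt0.
(* The first bound keeps the tilt within the robustness radius, the second
   keeps the error [del * dot d (s *: d)] below the gap [a - phi y]. *)
pose del := Num.min (alpha / (enorm d + 1) / 2)
  ((a - phi y) / (s * dot d d) / 2).
have del0 : 0 < del.
  by rewrite lt_min !divr_gt0.
have del_alpha : enorm ((- del) *: d) < alpha.
  rewrite enormZ normrN gtr0_norm//.
  apply: (@lt_le_trans _ _ (2 * del * (enorm d + 1))); first nra.
  rewrite -ler_pdivlMr ?ltr_wpDl// mulrC -ler_pdivlMr//.
  by rewrite ge_min lexx.
have del_a : del * (s * dot d d) < a - phi y.
  apply: (@lt_le_trans _ _ (2 * del * (s * dot d d))).
    nra.
  rewrite -ler_pdivlMr ?mulr_gt0// mulrC -ler_pdivlMr//.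
  by rewrite ge_min lexx orbT.
have tV : (fun k => (t k)^-1) @ \oo --> 0.
  by apply: (gtr0_cvgV0 _).2 => //; exact: (cvgryPgt _).1 ty 0.
pose z k := y + (s / t k) *: (x k - y).
have zd : (fun k => z k - y) @ \oo --> s *: d.
  have -> : (fun k => z k - y) =
      (fun k => s *: ((t k)^-1 *: x k - (t k)^-1 *: y)).
    apply/funext => k; rewrite /z addrAC subrr add0r -scalerA scalerBr.
    by rewrite scalerBr.
  have -> : s *: d = s *: (d - 0 *: y) by rewrite scale0r subr0.
  apply: cvgZl_tmp; apply: cvgB => //.
  exact: cvgZr_tmp.
have zyd : z @ \oo --> y + s *: d.
  have -> : z = (fun k => y + (z k - y)).
    by apply/funext => k; rewrite addrC subrK.
  by apply: cvgD => //; exact: cvg_cst.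
have dz : (fun k => del * dot d (z k - y)) @ \oo --> del * (s * dot d d).
  rewrite -(dotZr s); apply: cvgM; first exact: cvg_cst.
  exact: cvg_dot.
have xneg : (fun k => eta k - del * dot d ((t k)^-1 *: x k)) @ \oo -->
    - (del * dot d d).
  rewrite -sub0r; apply: cvgB => //; apply: cvgM; first exact: cvg_cst.
  exact: cvg_dot.
have dd2 : - (del * dot d d) < - (del * dot d d / 2).
  by rewrite ltrN2; have := mulr_gt0 del0 dd; lra.
(* Beyond [B] the tilted value at [x k], at most [- t k * del * dot d d / 2],
   is below the tilted value at [y]. *)
pose B := (del * dot d y - phi y) / (del * dot d d / 2).
near \oo => k.
have tk0 : 0 < t k by near: k; exact: (cvgryPgt _).1 ty _.
have stk : s < t k by near: k; exact: (cvgryPgt _).1 ty _.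
have Btk : B < t k by near: k; exact: (cvgryPgt _).1 ty _.
have azk : a < phi (z k) by near: k; exact: (zyd _ (lsc_near lsc _ _ ad)).
have dzk : del * dot d (z k - y) < a - phi y by near: k; exact: (cvgr_lt _ dz).
have negk : eta k - del * dot d ((t k)^-1 *: x k) < - (del * dot d d / 2).
  by near: k; exact: (cvgr_lt _ xneg).
have stk01 : 0 <= s / t k <= 1.
  by rewrite divr_ge0 ?(ltW s0) ?(ltW tk0)// ler_pdivrMr// mul1r ltW.
have := rq _ del_alpha y (x k) (s / t k) stk01.
rewrite -/(z k) leNgt => /negP; apply.
rewrite gt_max !dotZl !mulNr.
move: dzk; rewrite dotBr => dzk; apply/andP; split; first nra.
have := phix k.
move: negk Btk; rewrite dotZr ltr_pdivrMr; last by rewrite divr_gt0// mulr_gt0.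
move=> negk Btk pk.
set w := _^-1 * _ in negk; have -> : dot d (x k) = t k * w.
  by rewrite /w mulrA divff ?mul1r// gt_eqF.
have := ltr_pM2l tk0 (eta k - del * w) (- (del * dot d d / 2)).
rewrite negk; nra.
Unshelve. all: by end_near.
Qed.

(** * Minimizers of lower semicontinuous functions *)

(** Without a minimizer every point of [K] has a neighborhood on which [phi]
    stays above some value [phi y], [y] in [K].  The sets of reals below such
    values form a filter base, so compactness provides one [y] with
    [phi y < phi] on all of [K], which is absurd at [y] itself. *)
Lemma lsc_argmin {R : realType} {T : topologicalType} {K : set T}
    {phi : T -> R} :
  lower_semicontinuous (fun x => (phi x)%:E) -> compact K -> K !=set0 ->
  exists2 x, K x & forall y, K y -> phi x <= phi y.
Proof.
move=> lsc /compact_near_coveringP Kcov K0; apply: contrapT => nomin.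
pose F := filter_from K (fun y => [set c : R | c <= phi y]).
have FF : Filter F.
  apply: filter_from_filter => // x y Kx Ky.
  case: (leP (phi x) (phi y)) => xy; [exists x|exists y] => // c /= cxy.
    by split => //; exact: le_trans xy.
  by split => //; apply: le_trans (ltW xy).
have [y Ky /(_ (phi y) (lexx _) y Ky)] :
    \forall c \near F, K `<=` (fun x => c < phi x).
  apply: Kcov => x Kx.
  have [y [Ky yx]] : exists y, K y /\ phi y < phi x.
    apply: contrapT => nex; apply: nomin; exists x => // y Ky.
    by rewrite leNgt; apply/negP => yx; apply: nex; exists y.
  exists ([set x' | phi y < phi x'], [set c | c <= phi y]) => /=.
    by split; [exact: lsc_near lsc _ _ yx|exists y].
  by move=> [x' c] /= [xx' cy]; exact: le_lt_trans xx'.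
by rewrite ltxx.
Qed.

Lemma compact_closed_normr_le {R : realType} {n : nat} (X : set 'rV[R]_n) r :
  closed X -> compact (X `&` [set x | `|x| <= r]).
Proof.
move=> Xc; apply: bounded_closed_compact.
  exists r; split; first exact: num_real.
  by move=> s rs x [_ /= xr]; exact: le_trans (ltW rs).
apply: closedI => //.
apply: (@preimage_closed _ _ (fun x : 'rV[R]_n => `|x|) [set s | s <= r]).
  by move=> x _; exact: norm_continuous.
exact: closed_le.
Qed.

Lemma coercive_argmin {R : realType} {n : nat} (X : set 'rV[R]_n)
    (psi : 'rV[R]_n -> R) (c r : R) :
  closed X -> X !=set0 -> lower_semicontinuous (fun x => (psi x)%:E) ->
  0 < c -> (forall x, X x -> r <= `|x| -> c * `|x| < psi x) ->
  exists2 x, X x & forall y, X y -> psi x <= psi y.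
Proof.
move=> Xc [x0 Xx0] lsc c0 growth.
pose B := Num.max r (Num.max `|x0| (psi x0 / c)).
have [||x [Xx _] xmin] := lsc_argmin (K := X `&` [set x | `|x| <= B]) lsc.
- exact: compact_closed_normr_le.
- by exists x0; split; rewrite //= !le_max lexx orbT.
exists x => // y Xy; have [yB|By] := leP `|y| B; first exact: xmin.
have x0B : `|x0| <= B by rewrite !le_max lexx orbT.
apply: (le_trans (xmin x0 (conj Xx0 x0B))).
move: By; rewrite !gt_max => /and3P[ry _]; rewrite ltr_pdivrMr// mulrC => cy.
by rewrite ltW// (lt_trans cy)// growth// ltW.
Qed.

(** * Linear growth on X *)

(** Slope and radius are both read off one index [N], so that the estimates for
    the finitely many components hold simultaneously for large [N]. *)
Lemma linear_growth {R : realType} {n : nat} (alpha : R) (X : set 'rV[R]_n)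
    (phi : 'rV[R]_n -> R) :
  0 < alpha -> robustly_quasiconvex alpha phi ->
  lower_semicontinuous (fun y => (phi y)%:E) ->
  asymptotic_cone X `&` Kq phi `<=` [set 0] ->
  \forall N \near \oo, forall x, X x -> N.+1%:R <= `|x| ->
    N.+1%:R^-1 * `|x| < phi x.
Proof.
move=> alpha0 rq lsc asym.
pose P (N : nat) d := forall s : R, N.+1%:R <= s -> X (s *: d) ->
  N.+1%:R^-1 * s < phi (s *: d).
suff : \forall N \near \oo, [set d : 'rV[R]_n | `|d| = 1] `<=` P N.
  apply: filterS => N SP x Xx Nx.
  have x0 : 0 < `|x| by apply: lt_le_trans Nx; rewrite ltr0n.
  have xE : x = `|x| *: (`|x|^-1 *: x).
    by rewrite scalerA divff ?scale1r// gt_eqF.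
  rewrite [X in phi X]xE; apply: SP => //; rewrite -?xE//=.
  by rewrite normrZ normfV normr_id mulVf// gt_eqF.
have /compact_near_coveringP : compact [set d : 'rV[R]_n | `|d| = 1].
  have -> : [set d : 'rV[R]_n | `|d| = 1] =
      [set d | `|d| = 1] `&` [set d | `|d| <= 1].
    by apply/seteqP; split => [d /= d1|d [//]]; split => //=; rewrite d1.
  apply: compact_closed_normr_le.
  apply: (@preimage_closed _ _ (fun x : 'rV[R]_n => `|x|) [set s | s = 1]).
    by move=> x _; exact: norm_continuous.
  exact: closed_eq.
apply => d /= d1; apply: contrapT => nP.
have d0 : d != 0 by rewrite -normr_gt0 d1.
(* The estimate fails arbitrarily near [d] and arbitrarily far out.  A failure
   at index [N >= k] is also one at index [k]. *)
have seq k : exists p : R * 'rV[R]_n, [/\ k.+1%:R <= p.1,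
    `|d - p.2| < k.+1%:R^-1, X (p.1 *: p.2) &
    phi (p.1 *: p.2) <= k.+1%:R^-1 * p.1].
  apply: contrapT => nex; apply: nP.
  exists (ball d k.+1%:R^-1, [set N | (k <= N)%N]) => /=.
    split; last exact: nbhs_infty_ge.
    by apply: nbhsx_ballx; rewrite invr_gt0 ltr0n.
  move=> [d' N] /= [dd' kN] s Ns Xs; rewrite ltNge; apply/negP => phis.
  apply: nex; exists (s, d'); split => //=.
  - by apply: le_trans Ns; rewrite ler_nat ltnS.
  - by move: dd'; rewrite -ball_normE.
  - apply: (le_trans phis); rewrite ler_wpM2r//.
      by apply: le_trans Ns; rewrite ler0n.
    by rewrite lef_pV2 ?posrE ?ltr0n// ler_nat ltnS.
have [p pP] := choice seq.
have p0 k : 0 < (p k).1.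
  by have [kp _ _ _] := pP k; apply: lt_le_trans kp; rewrite ltr0n.
have py : (fun k => (p k).1) @ \oo --> +oo.
  apply/cvgryPge => A; near=> k; have [kp _ _ _] := pP k.
  apply: le_trans kp; apply: (@le_trans _ _ k%:R); last by rewrite ler_nat.
  by near: k; exact: nbhs_infty_ger.
have eta0 : (fun k => k.+1%:R^-1 : R) @ \oo --> 0 by exact: cvg_harmonic.
have pd : (fun k => (p k).1^-1 *: ((p k).1 *: (p k).2)) @ \oo --> d.
  under eq_cvg do rewrite scalerA mulVf ?gt_eqF// scale1r.
  apply/cvgrPdist_lt => e e0; near=> k.
  have [_ + _ _] := pP k; move/lt_trans; apply.
  by near: k; exact: (cvgr_lt _ eta0).
suff : [set 0] d by move=> /= dE; rewrite dE eqxx in d0.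
apply: asym; split.
  exists (fun k => (p k).1), (fun k => (p k).1 *: (p k).2).
  by split => // k; case: (pP k).
apply: (sublinear_direction_Kq _ _ _ _ _ _ alpha0 rq lsc d0 py eta0 pd).
by move=> k; case: (pP k).
Unshelve. all: by end_near.
Qed.

(** * Weak Pareto solutions of perturbed problems *)

Lemma comp_perturb {R : realType} {m n : nat} (f : 'rV[R]_n -> 'rV[R]_m) u i x :
  comp_fun (perturb f u) i x = comp_fun f i x - dot (row i u) x.
Proof. by rewrite /comp_fun /perturb !mxE. Qed.

(** Closedness of the graph of [Solw X f], stated for its complement because the
    compactness arguments consume it as a property holding near a point.  A
    point outside [X] stays outside; a domination by [x] persists because the
    gap in each component varies lower semicontinuously with the dominated
    point and with [u]. *)
Lemma near_not_Solw {R : realType} {m n : nat} {X : set 'rV[R]_n}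
    {f : 'rV[R]_n -> 'rV[R]_m} {u : 'M[R]_(m, n)} {z} :
  closed X ->
  (forall i, lower_semicontinuous (fun x => (comp_fun f i x)%:E)) ->
  ~ Solw X f u z -> \forall z' \near z & u' \near u, ~ Solw X f u' z'.
Proof.
move=> Xc lsc /not_andP[nXz|/contrapT[x Xx xz]].
  exists (~` X, setT) => /=; last by move=> p [nX _] [/nX].
  by split; [exact: open_nbhs_nbhs (conj (closed_openC Xc) nXz)|exact: filterT].
suff : \forall z' \near z & u' \near u, forall i,
    comp_fun (perturb f u') i x < comp_fun (perturb f u') i z'.
  by apply: filterS => p xp [_]; apply; exists x.
have FF : Filter (filter_prod (nbhs z) (nbhs u)) by exact: filter_prod_filter.
apply: (@filter_forall _ _ (fun i (p : 'rV[R]_n * 'M[R]_(m, n)) =>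
  comp_fun (perturb f p.2) i x < comp_fun (perturb f p.2) i p.1) _ FF) => i.
have := xz i; rewrite !comp_perturb => xzi.
pose g := comp_fun f i z - comp_fun f i x - dot (row i u) (z - x).
have g0 : 0 < g by rewrite /g dotBr; lra.
have gz : comp_fun f i z - g / 2 < comp_fun f i z by lra.
have dz : (fun p : 'rV[R]_n * 'M[R]_(m, n) => dot (row i p.2) (p.1 - x))
    @ filter_prod (nbhs z) (nbhs u) --> dot (row i u) (z - x).
  apply: cvg_dot_row; first exact: cvg_snd.
  by apply: cvgB; [exact: cvg_fst|exact: cvg_cst].
have gd : dot (row i u) (z - x) < dot (row i u) (z - x) + g / 2 by lra.
have H1 : \forall p \near filter_prod (nbhs z) (nbhs u),
    comp_fun f i z - g / 2 < comp_fun f i p.1.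
  exact: (cvg_fst (lsc_near (lsc i) _ _ gz)).
have H2 : \forall p \near filter_prod (nbhs z) (nbhs u),
    dot (row i p.2) (p.1 - x) < dot (row i u) (z - x) + g / 2.
  exact: (cvgr_lt _ dz).
apply: filterS2 H1 H2 => p /=; rewrite !comp_perturb /g !dotBr; lra.
Qed.

Lemma lsc_perturb {R : realType} {m n : nat} (f : 'rV[R]_n -> 'rV[R]_m) u i :
  lower_semicontinuous (fun x => (comp_fun f i x)%:E) ->
  lower_semicontinuous (fun x => (comp_fun (perturb f u) i x)%:E).
Proof.
move=> lsc x a; rewrite lte_fin comp_perturb => ax.
exists [set y | a < comp_fun (perturb f u) i y];
  last by move=> y; rewrite /= lte_fin.
pose g := comp_fun f i x - dot (row i u) x - a.
have g0 : 0 < g by rewrite /g; lra.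
have gx : comp_fun f i x - g / 2 < comp_fun f i x by lra.
have gd : dot (row i u) x < dot (row i u) x + g / 2 by lra.
have dx : dot (row i u) y @[y --> x] --> dot (row i u) x.
  exact: (cvg_dot id (row i u) x (fun=> id)).
have H2 : \forall y \near x, dot (row i u) y < dot (row i u) x + g / 2.
  exact: (cvgr_lt _ dx).
apply: filterS2 (lsc_near lsc _ _ gx) H2 => y /=.
by rewrite comp_perturb /g; lra.
Qed.

(** The bound on [u] leaves half of the slope [eta]. *)
Lemma perturb_growth {R : realType} {m n : nat} {X : set 'rV[R]_n}
    {f : 'rV[R]_n -> 'rV[R]_m} {eta r : R} {u : 'M[R]_(m, n)} :
  n%:R * `|u| <= eta / 2 ->
  (forall i x, X x -> r <= `|x| -> eta * `|x| < comp_fun f i x) ->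
  forall i x, X x -> r <= `|x| -> eta / 2 * `|x| < comp_fun (perturb f u) i x.
Proof.
move=> ueta growth i x Xx rx; rewrite comp_perturb.
have := growth i x Xx rx; have := normr_dot_le u i x.
have := ler_norm (dot (row i u) x).
by have := normr_ge0 x; nra.
Qed.

(** A weak solution is no worse than a fixed point [x0] of [X] in at least one
    component, and that component exceeds its value at [x0] far away. *)
Lemma Solw_bounded {R : realType} {m n : nat} {X : set 'rV[R]_n}
    {f : 'rV[R]_n -> 'rV[R]_m} {eta r : R} :
  X !=set0 -> 0 < eta ->
  (forall i x, X x -> r <= `|x| -> eta * `|x| < comp_fun f i x) ->
  exists B, forall u : 'M[R]_(m, n), n%:R * `|u| <= eta / 2 ->
    forall z, Solw X f u z -> `|z| <= B.
Proof.
move=> [x0 Xx0] eta0 growth.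
exists (Num.max r ((`|f x0| + eta / 2 * `|x0|) / (eta / 2))).
move=> u ueta z [Xz zopt].
rewrite le_max; have [//|/ltW rz /=] := leP `|z| r.
have [i zi] : exists i,
    comp_fun (perturb f u) i z <= comp_fun (perturb f u) i x0.
  apply: contrapT => nex; apply: zopt; exists x0 => // i.
  by rewrite ltNge; apply/negP => zi; apply: nex; exists i.
rewrite ler_pdivlMr ?divr_gt0// mulrC ltW//.
apply: (lt_le_trans (perturb_growth ueta growth i z Xz rz)).
apply: (le_trans zi); rewrite comp_perturb.
have := normr_coord_le (f x0) ord0 i; have := normr_dot_le u i x0.
have := ler_norm (comp_fun f i x0); have := ler_norm (- dot (row i u) x0).
by rewrite normrN /comp_fun; have := normr_ge0 x0; nra.
Qed.

(** * The stability theorem *)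

Theorem proposition5p1 (R : realType) (m n : nat) (X : set 'rV[R]_n)
    (alpha : R) (f : 'rV[R]_n -> 'rV[R]_m)
    (X_closed : closed X) (X_unbounded : ~ bounded_set X)
    (X_convex : convex_set X)
    (alpha_gt0 : 0 < alpha)
    (f_rqc : robustly_quasiconvex_map alpha f)
    (f_lsc : forall i : 'I_m,
       lower_semicontinuous (fun x : 'rV[R]_n => (comp_fun f i x)%:E))
    (f_asym : asymptotic_cone X `&`
       (\bigcup_(i in [set: 'I_m]) Kq (comp_fun f i)) = [set 0]) :
  exists2 eps : R, 0 < eps &
    forall u : 'M[R]_(m, n), fam_norm u < eps ->
      [/\ exists a : 'rV[R]_m,
            perturb f u @` X `<=` [set a + z | z in nonneg_orthant R m],
          Solw X f u !=set0 /\ compact (Solw X f u),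
          Lim_sup (Solw X f) (0 : 'M[R]_(m, n)) `<=` Solw X f 0 &
          upper_semicontinuous_at (Solw X f) (0 : 'M[R]_(m, n))].
Proof.
have X0 : X !=set0.
  apply/set0P/eqP => X0; apply: X_unbounded; rewrite X0.
  by exists 0; split; [exact: num_real|move=> s _ x []].
(* The hypothesis on the asymptotic cone forces at least one objective, since
   the union has to contain 0. *)
have [i0 _] : (\bigcup_(i in [set: 'I_m]) Kq (comp_fun f i)) 0.
  by have [] : (asymptotic_cone X `&`
    (\bigcup_(i in [set: 'I_m]) Kq (comp_fun f i))) 0 by rewrite f_asym.
have [eta [r [eta0 growth]]] : exists eta r : R, 0 < eta /\
    forall i x, X x -> r <= `|x| -> eta * `|x| < comp_fun f i x.
  have : \forall N \near \oo, forall i x, X x -> N.+1%:R <= `|x| ->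
      N.+1%:R^-1 * `|x| < comp_fun f i x.
    apply: filter_forall => i; apply: (linear_growth _ _ _ alpha_gt0) => //.
      exact: robustly_quasiconvex_comp.
    by move=> d [Xd Kd]; rewrite -f_asym; split => //; exists i.
  move=> [N _ /(_ N (leqnn N)) growth].
  by exists N.+1%:R^-1, N.+1%:R; rewrite invr_gt0 ltr0n.
have [B SB] := Solw_bounded X0 eta0 growth.
pose eps := eta / 2 / n.+1%:R.
have eps0 : 0 < eps by rewrite !divr_gt0// ltr0n.
have small (u : 'M[R]_(m, n)) : `|u| < eps -> n%:R * `|u| <= eta / 2.
  rewrite ltr_pdivlMr ?ltr0n// => /ltW; apply: le_trans.
  by rewrite mulrC ler_wpM2l// ler_nat.
have limsup : Lim_sup (Solw X f) (0 : 'M[R]_(m, n)) `<=` Solw X f 0.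
  move=> y [u [z [u0 zy uz]]]; apply: contrapT.
  move=> /(near_not_Solw X_closed f_lsc).
  move=> /(cvg_pair zy u0) [N _ /(_ N (leqnn N))]; apply; exact: uz.
exists eps => // u /(le_lt_trans (normr_le_fam_norm u)) /small ueta.
have argmin i : exists2 x, X x & forall y, X y ->
    comp_fun (perturb f u) i x <= comp_fun (perturb f u) i y.
  apply: (coercive_argmin _ _ (eta / 2) r) => //; first exact: lsc_perturb.
    by rewrite divr_gt0.
  exact: perturb_growth ueta growth i.
split => //.
- have /choice[xm xmP] i : exists x, forall y, X y ->
      comp_fun (perturb f u) i x <= comp_fun (perturb f u) i y.
    by have [x] := argmin i; exists x.
  exists (\row_i comp_fun (perturb f u) i (xm i)) => _ [x Xx <-].
  exists (perturb f u x - \row_i comp_fun (perturb f u) i (xm i)).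
    by move=> i; rewrite !mxE subr_ge0; have := xmP i x Xx;
      rewrite /comp_fun !mxE.
  by rewrite addrC subrK.
- split.
    have [x Xx xmin] := argmin i0; exists x; split => // -[y Xy /(_ i0)].
    by rewrite ltNge xmin.
  apply: bounded_closed_compact.
    exists B; split; first exact: num_real.
    by move=> s Bs z /(SB u ueta) zB; exact: le_trans (ltW Bs).
  rewrite -openC openE => z.
  move=> /(near_not_Solw X_closed f_lsc) [[A C] [/= zA uC]] AC.
  apply: filterS zA => z' Az'; apply: (AC (z', u)); split => //=.
  exact: nbhs_singleton.
- move=> V Vo SV.
  (* Near each point of the ball containing all solutions, a solution for small
     [u] lies in [V]; compactness makes the smallness of [u] uniform. *)
  have /compact_near_coveringP :=
    compact_closed_normr_le [set: 'rV[R]_n] B closedT.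
  move=> /(_ _ (nbhs (0 : 'M[R]_(m, n)))
    (fun u z => Solw X f u z -> V z) _) cov.
  have : \forall u \near (0 : 'M[R]_(m, n)),
      setT `&` [set x | `|x| <= B] `<=` (fun z => Solw X f u z -> V z).
    apply: cov => z _; have [Vz|nVz] := pselect (V z).
      exists (V, setT) => /=; last by move=> p [].
      by split; [exact: open_nbhs_nbhs|exact: filterT].
    have /(near_not_Solw X_closed f_lsc) : ~ Solw X f 0 z by move=> /SV.
    by apply: filterS => p nS /nS.
  have near_small : \forall v \near (0 : 'M[R]_(m, n)), `|v| < eps.
    exact: pseudometric_normed_Zmodule.nbhs0_lt.
  move=> VB; near=> v => z Sz.
  have /small vs : `|v| < eps by near: v.
  suff : setT `&` [set x | `|x| <= B] `<=` (fun z => Solw X f v z -> V z).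
    by apply => //; split => //; exact: SB Sz.
  by near: v.
Unshelve. all: by end_near.
Qed.
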